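(* Let $(X,d)$ be a metric space with $|X|\ge 3$ and let $T:X\to X$ be a mapping contracting hypotenuse of a right-angled triangle which has no periodic points of prime period $2$. Assume that $X$ contains infinitely many points and that $x_0\in X$ is a point for which the iterative sequence $x_0,\ x_1=Tx_0,\ x_2=Tx_1,\dots$ converges to a point $u\in X$ with $u\ne x_n$ for all $n\in\mathbb{N}\cup\{0\}$. Then $u$ is the unique fixed point of $T$.
   Context: Let $(X,d)$ be a metric space with $|X|\ge 3$. A mapping $T:X\to X$ is called a mapping contracting hypotenuse of a right-angled triangle if there exists $\beta$ with $0\le\beta<1$ such that $$[d(Tx,Ty)]^2+[d(Ty,Tz)]^2\le \beta\left([d(x,y)]^2+[d(y,z)]^2\right)$$ for any three pairwise distinct points $x,y,z\in X$. A periodic point of $T$ of prime period $2$ is a point $x\in X$ with $T(Tx)=x$ and $Tx\ne x$. *)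

(* Defs.v *)
From mathcomp Require Import all_boot all_order all_algebra.
From mathcomp Require Import all_classical all_reals all_analysis.

Set Implicit Arguments.
Unset Strict Implicit.
Unset Printing Implicit Defensive.

Import Order.TTheory GRing.Theory Num.Theory.

Local Open Scope ring_scope.

Definition hypotenuse_contracting (R : realType) (X : metricType R)
    (T : X -> X) : Prop :=
  exists beta : R, 0 <= beta < 1 /\
    forall x y z : X, x <> y -> y <> z -> x <> z ->
      mdist (T x) (T y) ^+ 2 + mdist (T y) (T z) ^+ 2
        <= beta * (mdist x y ^+ 2 + mdist y z ^+ 2).

Definition periodic_prime_period2 (X : Type) (T : X -> X) (x : X) : Prop :=
  T (T x) = x /\ T x <> x.

(* Main.v *)
Require Import Defs.
From mathcomp Require Import all_boot all_order all_algebra.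
From mathcomp Require Import all_classical all_reals all_analysis.
From mathcomp Require Import lra.

(** Write [x_n] for the iterates.  The orbit never meets a fixed point: if it
    did, it would be constant from there on, and its limit [u] would lie on the
    orbit.  So any two consecutive iterates differ, and the contraction
    inequality applies to every triple [u, x_n, x_{n+1}].  Letting [n] tend to
    infinity there, by continuity of the distance, leaves
    [d(Tu,u)^2 <= beta * 0], so [u] is fixed.  If [v] were a second fixed
    point, then [u, v, x_n] would be pairwise distinct as well, and the
    inequality for this triple would become [2 d(u,v)^2 <= 2 beta d(u,v)^2] in
    the limit, which is absurd because [beta < 1] and [d(u,v) > 0]. *)

Import Order.TTheory GRing.Theory Num.Theory.
Import numFieldNormedType.Exports.

Local Open Scope classical_set_scope.
Local Open Scope card_scope.
Local Open Scope ring_scope.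

Lemma cvg_mdist {R : realType} {X : metricType R} {I : Type}
    {F : set_system I} {FF : Filter F} {f g : I -> X} {a b : X} :
  f @ F --> a -> g @ F --> b ->
  (fun i => mdist (f i) (g i)) @ F --> mdist a b.
Proof.
move=> fa gb; apply/cvgrPdist_lt => e e0.
have e20 : 0 < e / 2 by rewrite divr_gt0.
have fe := metricType_numDomainType.cvgr_dist_lt fa e20.
have ge := metricType_numDomainType.cvgr_dist_lt gb e20.
apply: (filterS2 _ _ (fe FF) (ge FF)) => i fi gi.
have := metric_triangle a (f i) b; have := metric_triangle (f i) (g i) b.
have := metric_triangle (f i) a (g i); have := metric_triangle a b (g i).
have fiE := metric_sym (f i) a; have giE := metric_sym (g i) b.
by rewrite ltr_norml; lra.
Qed.

(** An orbit that reaches a fixed point is eventually constant, hence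
    converges to a point of itself. *)
Lemma orbit_avoids_fixpoint {R : realType} {X : metricType R} {T : X -> X}
    {x0 u : X} (cvg_iter : (fun n : nat => iter n T x0) @ \oo --> u)
    (u_notin_orbit : forall n : nat, u <> iter n T x0) {w : X} :
  T w = w -> forall n, iter n T x0 <> w.
Proof.
move=> Tw n xnw; apply: (u_notin_orbit n); rewrite xnw.
apply: (@cvg_unique _ (@metric_hausdorff _ X) _ _ _ _ cvg_iter).
apply: cvg_near_cst; exists n => // m /= /subnK <-.
by elim: (m - n)%N => // k IHk; rewrite addSn iterS IHk.
Qed.

Lemma cvg_hypotenuse {R : realType} {X : metricType R} {f g h : nat -> X}
    {a b c : X} :
  f @ \oo --> a -> g @ \oo --> b -> h @ \oo --> c ->
  (fun n => mdist (f n) (g n) ^+ 2 + mdist (g n) (h n) ^+ 2) @ \oo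
    --> mdist a b ^+ 2 + mdist b c ^+ 2.
Proof.
move=> fa gb hc; rewrite !expr2.
by apply: cvgD; apply: cvgM; apply: cvg_mdist.
Qed.

(** The contraction inequality is closed, so it survives the passage to the
    limit even when the limiting points are no longer pairwise distinct. *)
Lemma hypotenuse_le_lim {R : realType} {X : metricType R} (beta : R)
    {f g h f' g' h' : nat -> X} {a b c a' b' c' : X} :
  f @ \oo --> a -> g @ \oo --> b -> h @ \oo --> c ->
  f' @ \oo --> a' -> g' @ \oo --> b' -> h' @ \oo --> c' ->
  (forall n, mdist (f' n) (g' n) ^+ 2 + mdist (g' n) (h' n) ^+ 2
    <= beta * (mdist (f n) (g n) ^+ 2 + mdist (g n) (h n) ^+ 2)) ->
  mdist a' b' ^+ 2 + mdist b' c' ^+ 2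
    <= beta * (mdist a b ^+ 2 + mdist b c ^+ 2).
Proof.
move=> fa gb hc fa' gb' hc' le_n.
apply: (ler_cvg_to (cvg_hypotenuse fa' gb' hc')
  (cvgMl_tmp (a := beta) (cvg_hypotenuse fa gb hc))).
by apply: nearW => n; exact: le_n.
Qed.

Theorem theorem2p9 (R : realType) (X : metricType R)
    (card_X : [set: 'I_3] #<= [set: X])
    (T : X -> X) (contrT : hypotenuse_contracting T)
    (no_period2 : ~ (exists x : X, periodic_prime_period2 T x))
    (infinite_X : infinite_set [set: X])
    (x0 u : X)
    (cvg_iter : (fun n : nat => iter n T x0) @ \oo --> u)
    (u_notin_orbit : forall n : nat, u <> iter n T x0) :
  T u = u /\ (forall v : X, T v = v -> v = u).
Proof.
have [beta [/andP[_ beta_lt1] contr]] := contrT.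
have cvg_tail k : (fun n => iter (k + n) T x0) @ \oo --> u.
  by apply: cvg_comp (cvg_addnl k) cvg_iter.
have [cvg1 cvg2] := (cvg_tail 1%N, cvg_tail 2%N).
have cst (w : X) : (fun _ : nat => w) @ \oo --> w by exact: cvg_cst.
have avoid := orbit_avoids_fixpoint cvg_iter u_notin_orbit.
have Tu : T u = u.
  apply/esym/mdist_positivity.
  have := hypotenuse_le_lim beta (cst u) cvg_iter cvg1 (cst (T u)) cvg1 cvg2.
  rewrite !mdistxx !expr0n !addr0 mulr0 metric_sym => lim_le.
  apply/eqP; rewrite -sqrf_eq0 eq_le sqr_ge0 andbT; apply: lim_le => n.
  apply: (contr u (iter n T x0) (iter n.+1 T x0)).
  - exact: u_notin_orbit.
  (* Equal consecutive iterates would make [x_n] a fixed point on the orbit. *)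
  - by move=> fixn; apply: (avoid _ (esym fixn) n).
  - exact: u_notin_orbit.
split=> // v Tv; apply: contrapT => neq_vu.
have lim_le :=
  hypotenuse_le_lim beta (cst u) (cst v) cvg_iter (cst u) (cst v) cvg1.
have {lim_le} : mdist u v ^+ 2 + mdist v u ^+ 2 <=
    beta * (mdist u v ^+ 2 + mdist v u ^+ 2).
  apply: lim_le => n; have := contr u v (iter n T x0); rewrite Tu Tv; apply.
  - by move/esym.
  - by move/esym; apply: avoid.
  - exact: u_notin_orbit.
rewrite leNgt gtr_pMl ?beta_lt1 //.
have duv_gt0 : 0 < mdist u v by rewrite mdist_gt0; apply/eqP => /esym.
by rewrite [mdist v u]metric_sym addr_gt0 // exprn_gt0.
Qed.
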